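(* Let $d\geq1$ be an odd integer and let $k_0,k_1,k_2,k_3$ be nonzero scalars in $\mathbb{F}$ with $k_0^2=q^{-d-1}$. Let $N(k_0,k_1,k_2,k_3)$ be the $\mathfrak{H}_q$-submodule of $M(k_0,k_1,k_2,k_3)$ generated by $m_{d+1}$. There exists a unique $\mathfrak{H}_q$-module isomorphism $$M(k_0,k_1,k_2,k_3)/N(k_0,k_1,k_2,k_3)\to E(k_0,k_1,k_2,k_3)$$ that sends $m_i+N(k_0,k_1,k_2,k_3)$ to $v_i$ for all $i=0,1,\ldots,d$.
   Context: $\mathbb{F}$ is a field and $q\in\mathbb{F}$ is nonzero. The universal DAHA $\mathfrak{H}_q$ of type $(C_1^\vee,C_1)$ is the unital associative $\mathbb{F}$-algebra with generators $t_0^{\pm1},t_1^{\pm1},t_2^{\pm1},t_3^{\pm1}$ and relations: $t_it_i^{-1}=t_i^{-1}t_i=1$ for all $i$; $t_i+t_i^{-1}$ is central for all $i$; $t_0t_1t_2t_3=q^{-1}$. For nonzero $k_0,k_1,k_2,k_3\in\mathbb{F}$, $M(k_0,k_1,k_2,k_3)$ denotes the $\mathfrak{H}_q$-module with $\mathbb{F}$-basis $\{m_i\}_{i=0}^\infty$ and action - $t_0m_i=k_0^{-1}q^{-i}(1-q^i)(1-k_0^2q^i)m_{i-1}+(k_0+k_0^{-1}-k_0^{-1}q^{-i})m_i$ for $i=2,4,\ldots$; $t_0m_i=k_0^{-1}q^{-i-1}(m_i-m_{i+1})$ for $i=1,3,\ldots$; $t_0m_0=k_0m_0$; - $t_1m_i=-k_1(1-q^i)(1-k_0^2q^i)m_{i-1}+k_1m_i+k_1^{-1}m_{i+1}$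 for $i=2,4,\ldots$; $t_1m_i=k_1^{-1}m_i$ for $i=1,3,\ldots$; $t_1m_0=k_1m_0+k_1^{-1}m_1$; - $t_2m_i=k_0^{-1}k_1^{-1}k_3^{-1}q^{-i-1}(m_i-m_{i+1})$ for $i=0,2,\ldots$; $t_2m_i=\frac{(k_0k_1k_3q^i-k_2)(k_0k_1k_3q^i-k_2^{-1})}{k_0k_1k_3q^i}m_{i-1}+(k_2+k_2^{-1}-k_0^{-1}k_1^{-1}k_3^{-1}q^{-i})m_i$ for $i=1,3,\ldots$; - $t_3m_i=k_3m_i$ for $i=0,2,\ldots$; $t_3m_i=-k_3^{-1}(k_0k_1k_3q^i-k_2)(k_0k_1k_3q^i-k_2^{-1})m_{i-1}+k_3^{-1}m_i+k_3m_{i+1}$ for $i=1,3,\ldots$. For an odd integer $d\ge1$ and nonzero $k_0,k_1,k_2,k_3\in\mathbb{F}$ with $k_0^2=q^{-d-1}$, $E(k_0,k_1,k_2,k_3)$ denotes the $(d+1)$-dimensional $\mathfrak{H}_q$-module with $\mathbb{F}$-basis $\{v_i\}_{i=0}^d$ and action - $t_0v_i=k_0^{-1}q^{-i}(1-q^i)(1-k_0^2q^i)v_{i-1}+(k_0+k_0^{-1}-k_0^{-1}q^{-i})v_i$ for $i=2,4,\ldots,d-1$; $t_0v_i=k_0^{-1}q^{-i-1}(v_i-v_{i+1})$ for $i=1,3,\ldots,d-2$; $t_0v_0=k_0v_0$; $t_0v_d=k_0v_d$; - $t_1v_i=-k_1(1-q^i)(1-k_0^2q^i)v_{i-1}+k_1v_i+k_1^{-1}v_{i+1}$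 for $i=2,4,\ldots,d-1$; $t_1v_i=k_1^{-1}v_i$ for $i=1,3,\ldots,d$; $t_1v_0=k_1v_0+k_1^{-1}v_1$; - $t_2v_i=k_0^{-1}k_1^{-1}k_3^{-1}q^{-i-1}(v_i-v_{i+1})$ for $i=0,2,\ldots,d-1$; $t_2v_i=\frac{(k_0k_1k_3q^i-k_2)(k_0k_1k_3q^i-k_2^{-1})}{k_0k_1k_3q^i}v_{i-1}+(k_2+k_2^{-1}-k_0^{-1}k_1^{-1}k_3^{-1}q^{-i})v_i$ for $i=1,3,\ldots,d$; - $t_3v_i=k_3v_i$ for $i=0,2,\ldots,d-1$; $t_3v_i=-k_3^{-1}(k_0k_1k_3q^i-k_2)(k_0k_1k_3q^i-k_2^{-1})v_{i-1}+k_3^{-1}v_i+k_3v_{i+1}$ for $i=1,3,\ldots,d-2$; $t_3v_d=-k_3^{-1}(k_0k_1k_3q^d-k_2)(k_0k_1k_3q^d-k_2^{-1})v_{d-1}+k_3^{-1}v_d$. (These formulas do define $\mathfrak{H}_q$-modules.) *)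

(* Defs.v *)
From HB Require Import structures.
From mathcomp Require Import all_boot all_order all_algebra.
From mathcomp Require Import boolp.
From mathcomp Require Import ring.

Set Implicit Arguments.
Unset Strict Implicit.
Unset Printing Implicit Defensive.

Import GRing.Theory.
Local Open Scope ring_scope.
Local Open Scope quotient_scope.

Definition i0 : 'I_4 := @Ordinal 4 0 isT.
Definition i1 : 'I_4 := @Ordinal 4 1 isT.
Definition i2 : 'I_4 := @Ordinal 4 2 isT.
Definition i3 : 'I_4 := @Ordinal 4 3 isT.

(* The universal DAHA of type (C_1^vee, C_1) is built from its presentation:
   formal expressions in the letters t_i, t_i^-1 modulo the congruence
   generated by the axioms of unital associative F-algebras and the defining
   relations. *)

Inductive dterm (F : Type) : Type :=
| DConst of F
| DGen of 'I_4
| DInv of 'I_4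
| DAdd of dterm F & dterm F
| DOpp of dterm F
| DMul of dterm F & dterm F.

Arguments DGen {F}.
Arguments DInv {F}.

HB.instance Definition _ (F : Type) := gen_eqMixin (dterm F).
HB.instance Definition _ (F : Type) := gen_choiceMixin (dterm F).

Section Presentation.
Variables (F : fieldType) (q : F).
Implicit Types x y z : dterm F.

Inductive dcongr : dterm F -> dterm F -> Prop :=
| dc_refl x : dcongr x x
| dc_sym x y : dcongr x y -> dcongr y x
| dc_trans x y z : dcongr x y -> dcongr y z -> dcongr x z
| dc_add x x' y y' :
    dcongr x x' -> dcongr y y' -> dcongr (DAdd x y) (DAdd x' y')
| dc_opp x x' : dcongr x x' -> dcongr (DOpp x) (DOpp x')
| dc_mul x x' y y' :
    dcongr x x' -> dcongr y y' -> dcongr (DMul x y) (DMul x' y')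
| dc_addA x y z : dcongr (DAdd x (DAdd y z)) (DAdd (DAdd x y) z)
| dc_addC x y : dcongr (DAdd x y) (DAdd y x)
| dc_add0 x : dcongr (DAdd (DConst 0) x) x
| dc_addN x : dcongr (DAdd (DOpp x) x) (DConst 0)
| dc_mulA x y z : dcongr (DMul x (DMul y z)) (DMul (DMul x y) z)
| dc_mul1 x : dcongr (DMul (DConst 1) x) x
| dc_mul1r x : dcongr (DMul x (DConst 1)) x
| dc_mulDl x y z : dcongr (DMul (DAdd x y) z) (DAdd (DMul x z) (DMul y z))
| dc_mulDr x y z : dcongr (DMul x (DAdd y z)) (DAdd (DMul x y) (DMul x z))
| dc_constD a b : dcongr (DConst (a + b)) (DAdd (DConst a) (DConst b))
| dc_constM a b : dcongr (DConst (a * b)) (DMul (DConst a) (DConst b))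
| dc_constC a x : dcongr (DMul (DConst a) x) (DMul x (DConst a))
| dc_genK i : dcongr (DMul (DGen i) (DInv i)) (DConst 1)
| dc_invK i : dcongr (DMul (DInv i) (DGen i)) (DConst 1)
| dc_central i x :
    dcongr (DMul (DAdd (DGen i) (DInv i)) x) (DMul x (DAdd (DGen i) (DInv i)))
| dc_prod :
    dcongr (DMul (DMul (DMul (DGen i0) (DGen i1)) (DGen i2)) (DGen i3))
           (DConst q^-1).

Definition dequiv (x y : dterm F) : bool := `[< dcongr x y >].

Lemma dequiv_class : equiv_class_of dequiv.
Proof.
split=> [x|x y|y x z].
- exact/asboolP/dc_refl.
- by apply/asboolP/asboolP; apply: dc_sym.
- by move=> /asboolP xy /asboolP yz; apply/asboolP; apply: dc_trans xy yz.
Qed.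

Canonical dequiv_equiv := EquivRelPack dequiv_class.
Canonical dequiv_encModRel := defaultEncModRel dequiv.

End Presentation.

(* [q_neq0] is not used by the construction; it makes the algebra nontrivial,
   which the ring structures below need. *)
Definition DAHA (F : fieldType) (q : F) (q_neq0 : q != 0) : Type :=
  {eq_quot dequiv q}.

Section Algebra.
Variables (F : fieldType) (q : F) (q_neq0 : q != 0).
Local Notation H := (DAHA q_neq0).

HB.instance Definition _ := Choice.on H.
HB.instance Definition _ : EqQuotient _ (dequiv q) H := EqQuotient.on H.

Definition dpi (x : dterm F) : H := \pi_H x.

Lemma dpiP x y : reflect (dpi x = dpi y) `[< dcongr q x y >].
Proof.
by apply: (iffP idP) => [h|/eqP]; [apply/eqP; rewrite piE | rewrite piE].
Qed.

Lemma dpi_eq x y : dcongr q x y -> dpi x = dpi y.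
Proof. by move=> h; apply/dpiP/asboolP. Qed.

Lemma dpi_inj x y : dpi x = dpi y -> dcongr q x y.
Proof. by move=> /dpiP/asboolP. Qed.

Lemma dreprK (h : H) : dpi (repr h) = h.
Proof. exact: reprK. Qed.

Lemma dpi_surj (h : H) : exists x, h = dpi x.
Proof. by exists (repr h); rewrite dreprK. Qed.

Definition dadd (g h : H) : H := dpi (DAdd (repr g) (repr h)).
Definition dopp (g : H) : H := dpi (DOpp (repr g)).
Definition dmul (g h : H) : H := dpi (DMul (repr g) (repr h)).

Lemma repr_congr x : dcongr q (repr (dpi x)) x.
Proof. by apply: dpi_inj; rewrite dreprK. Qed.

Lemma daddE x y : dadd (dpi x) (dpi y) = dpi (DAdd x y).
Proof. by apply: dpi_eq; apply: dc_add; apply: repr_congr. Qed.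
Lemma doppE x : dopp (dpi x) = dpi (DOpp x).
Proof. by apply: dpi_eq; apply: dc_opp; apply: repr_congr. Qed.
Lemma dmulE x y : dmul (dpi x) (dpi y) = dpi (DMul x y).
Proof. by apply: dpi_eq; apply: dc_mul; apply: repr_congr. Qed.

Lemma daddA : associative dadd.
Proof.
move=> x y z; case: (dpi_surj x) (dpi_surj y) (dpi_surj z) => {}x -> [{}y ->] [{}z ->].
by rewrite !daddE; apply/dpi_eq/dc_addA.
Qed.
Lemma daddC : commutative dadd.
Proof.
move=> x y; case: (dpi_surj x) (dpi_surj y) => {}x -> [{}y ->].
by rewrite !daddE; apply/dpi_eq/dc_addC.
Qed.
Lemma dadd0 : left_id (dpi (DConst 0)) dadd.
Proof.
by move=> x; case: (dpi_surj x) => {}x ->; rewrite daddE; apply/dpi_eq/dc_add0.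
Qed.
Lemma daddN : left_inverse (dpi (DConst 0)) dopp dadd.
Proof.
move=> x; case: (dpi_surj x) => {}x ->; rewrite doppE daddE.
exact/dpi_eq/dc_addN.
Qed.
HB.instance Definition _ := GRing.isZmodule.Build H daddA daddC dadd0 daddN.

Lemma dmulA : associative dmul.
Proof.
move=> x y z; case: (dpi_surj x) (dpi_surj y) (dpi_surj z) => {}x -> [{}y ->] [{}z ->].
by rewrite !dmulE; apply/dpi_eq/dc_mulA.
Qed.
Lemma dmul1 : left_id (dpi (DConst 1)) dmul.
Proof.
by move=> x; case: (dpi_surj x) => {}x ->; rewrite dmulE; apply/dpi_eq/dc_mul1.
Qed.
Lemma dmul1r : right_id (dpi (DConst 1)) dmul.
Proof.
by move=> x; case: (dpi_surj x) => {}x ->; rewrite dmulE; apply/dpi_eq/dc_mul1r.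
Qed.
Lemma dmulDl : left_distributive dmul +%R.
Proof.
move=> x y z; case: (dpi_surj x) (dpi_surj y) (dpi_surj z) => {}x -> [{}y ->] [{}z ->].
by rewrite /GRing.add /= !(dmulE, daddE); apply/dpi_eq/dc_mulDl.
Qed.
Lemma dmulDr : right_distributive dmul +%R.
Proof.
move=> x y z; case: (dpi_surj x) (dpi_surj y) (dpi_surj z) => {}x -> [{}y ->] [{}z ->].
by rewrite /GRing.add /= !(dmulE, daddE); apply/dpi_eq/dc_mulDr.
Qed.
HB.instance Definition _ :=
  GRing.Zmodule_isPzRing.Build H dmulA dmul1 dmul1r dmulDl dmulDr.

Lemma dpiD x y : dpi (DAdd x y) = dpi x + dpi y.
Proof. by rewrite -daddE. Qed.
Lemma dpiN x : dpi (DOpp x) = - dpi x.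
Proof. by rewrite -doppE. Qed.
Lemma dpiM x y : dpi (DMul x y) = dpi x * dpi y.
Proof. by rewrite -dmulE. Qed.
Lemma dpi1 : dpi (DConst 1) = 1.
Proof. by []. Qed.

Definition dscale (a : F) (h : H) : H := dpi (DConst a) * h.

Lemma dscaleA a b h : dscale a (dscale b h) = dscale (a * b) h.
Proof. by rewrite /dscale mulrA -dpiM; congr (_ * _); apply/esym/dpi_eq/dc_constM. Qed.
Lemma dscale1 : left_id 1 dscale.
Proof. by move=> h; rewrite /dscale dpi1 mul1r. Qed.
Lemma dscaleDr : right_distributive dscale +%R.
Proof. by move=> a g h; rewrite /dscale mulrDr. Qed.
Lemma dscaleDl h : {morph dscale^~ h : a b / a + b}.
Proof.
by move=> a b; rewrite /dscale -mulrDl -dpiD; congr (_ * _); apply/dpi_eq/dc_constD.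
Qed.
HB.instance Definition _ :=
  GRing.Zmodule_isLmodule.Build F H dscaleA dscale1 dscaleDr dscaleDl.

Lemma dpiC a : dpi (DConst a) = a *: (1 : H).
Proof. by rewrite /GRing.scale /= /dscale mulr1. Qed.

Lemma dscaleAl a (g h : H) : a *: (g * h) = (a *: g) * h.
Proof. by rewrite /GRing.scale /= /dscale mulrA. Qed.
Lemma dscaleAr a (g h : H) : a *: (g * h) = g * (a *: h).
Proof.
rewrite /GRing.scale /= /dscale !mulrA; congr (_ * _).
by case: (dpi_surj g) => x ->; rewrite -!dpiM; apply/dpi_eq/dc_constC.
Qed.

Definition tgen (i : 'I_4) : H := dpi (DGen i).
Definition tinv (i : 'I_4) : H := dpi (DInv i).

Lemma tgenK i : tgen i * tinv i = 1.
Proof. by rewrite -dpiM; apply/dpi_eq/dc_genK. Qed.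
Lemma tinvK i : tinv i * tgen i = 1.
Proof. by rewrite -dpiM; apply/dpi_eq/dc_invK. Qed.
Lemma tgen_central i (h : H) : (tgen i + tinv i) * h = h * (tgen i + tinv i).
Proof.
by case: (dpi_surj h) => x ->; rewrite -dpiD -!dpiM; apply/dpi_eq/dc_central.
Qed.
Lemma tgen_prod : tgen i0 * tgen i1 * tgen i2 * tgen i3 = q^-1 *: (1 : H).
Proof. by rewrite /tgen -dpiC -(dpi_eq (dc_prod q)) !dpiM. Qed.

End Algebra.

(* An H_q-module structure extending a given F-space structure amounts to
   F-linear operators T_i, T_i^-1 satisfying the defining relations. *)
Record DAHA_rep (F : fieldType) (q : F) (V : lmodType F) := DAHARep {
  rop : 'I_4 -> V -> V;
  ropV : 'I_4 -> V -> V;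
  rop_linear : forall i, linear (rop i);
  ropV_linear : forall i, linear (ropV i);
  ropK : forall i, cancel (rop i) (ropV i);
  ropVK : forall i, cancel (ropV i) (rop i);
  rop_central : forall i j v,
    rop i (rop j v) + ropV i (rop j v) = rop j (rop i v + ropV i v);
  rop_prod : forall v,
    rop i0 (rop i1 (rop i2 (rop i3 v))) = q^-1 *: v
}.

Definition rep_module (F : fieldType) (q : F) (q_neq0 : q != 0)
  (V : lmodType F) (rho : DAHA_rep q V) : Type := V.

Section RepModule.
Variables (F : fieldType) (q : F) (q_neq0 : q != 0).
Variables (V : lmodType F) (rho : DAHA_rep q V).
Local Notation H := (DAHA q_neq0).
Local Notation W := (rep_module q_neq0 rho).

HB.instance Definition _ := GRing.Zmodule.on W.

Fixpoint deval (x : dterm F) (v : V) : V :=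
  match x with
  | DConst a => a *: v
  | DGen i => rop rho i v
  | DInv i => ropV rho i v
  | DAdd x y => deval x v + deval y v
  | DOpp x => - deval x v
  | DMul x y => deval x (deval y v)
  end.

Lemma deval_linear x : linear (deval x).
Proof.
elim: x => [b|i|i|x IHx y IHy|x IHx|x IHx y IHy] a u v /=.
- by rewrite scalerDr !scalerA mulrC.
- exact: rop_linear.
- exact: ropV_linear.
- by rewrite IHx IHy scalerDr addrACA.
- by rewrite IHx opprD scalerN.
- by rewrite IHy IHx.
Qed.

Lemma devalD x u v : deval x (u + v) = deval x u + deval x v.
Proof. by have := deval_linear x 1 u v; rewrite !scale1r. Qed.
Lemma deval0 x : deval x 0 = 0.
Proof. by apply: (addrI (deval x 0)); rewrite -devalD !addr0. Qed.
Lemma devalZ x a v : deval x (a *: v) = a *: deval x v.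
Proof. by have := deval_linear x a v 0; rewrite !addr0 deval0 addr0. Qed.

Lemma devalN x u : deval x (- u) = - deval x u.
Proof. by rewrite -scaleN1r devalZ scaleN1r. Qed.

Lemma rop_central_deval i x v :
  deval x (deval (DAdd (DGen i) (DInv i)) v) =
  deval (DAdd (DGen i) (DInv i)) (deval x v).
Proof.
set z := DAdd _ _.
elim: x v => [b|j|j|x IHx y IHy|x IHx|x IHx y IHy] v.
- exact: (esym (devalZ z b v)).
- by rewrite /= rop_central.
- apply: (can_inj (ropK rho j)).
  by rewrite /= ropVK -(rop_central rho i j) ropVK.
- have -> : deval (DAdd x y) v = deval x v + deval y v by [].
  by rewrite devalD -IHx -IHy.
- have -> : deval (DOpp x) v = - deval x v by [].
  by rewrite devalN -IHx.
- have -> : deval (DMul x y) v = deval x (deval y v) by [].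
  by rewrite -IHx -IHy.
Qed.

Lemma deval_congr x y : dcongr q x y -> deval x =1 deval y.
Proof.
elim=> {x y} /=.
- by [].
- by move=> x y _ IH v.
- by move=> x y z _ IH1 _ IH2 v; rewrite IH1.
- by move=> x x' y y' _ IH1 _ IH2 v; rewrite IH1 IH2.
- by move=> x x' _ IH v; rewrite IH.
- by move=> x x' y y' _ IH1 _ IH2 v; rewrite IH1 IH2.
- by move=> x y z v; rewrite addrA.
- by move=> x y v; rewrite addrC.
- by move=> x v; rewrite scale0r add0r.
- by move=> x v; rewrite addNr scale0r.
- by [].
- by move=> x v; rewrite scale1r.
- by move=> x v; rewrite scale1r.
- by [].
- by move=> x y z v; rewrite devalD.
- by move=> a b v; rewrite scalerDl.
- by move=> a b v; rewrite scalerA.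
- by move=> a x v; rewrite devalZ.
- by move=> i v; rewrite ropVK scale1r.
- by move=> i v; rewrite ropK scale1r.
- by move=> i x v; exact: (esym (rop_central_deval i x v)).
- by move=> v; rewrite rop_prod.
Qed.

Definition rscale (h : H) (v : W) : W := deval (repr h) v.

Lemma rscaleE x (v : W) : rscale (dpi q_neq0 x) v = deval x v.
Proof. by apply: deval_congr; apply: repr_congr. Qed.

Lemma rscaleA g h v : rscale g (rscale h v) = rscale (g * h) v.
Proof.
by case: (dpi_surj g) (dpi_surj h) => x -> [y ->]; rewrite -dpiM !rscaleE.
Qed.
Lemma rscale1 : left_id 1 rscale.
Proof. by move=> v; rewrite -dpi1 rscaleE /= scale1r. Qed.
Lemma rscaleDr : right_distributive rscale +%R.
Proof. by move=> g u v; rewrite /rscale [LHS]devalD. Qed.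
Lemma rscaleDl v : {morph rscale^~ v : g h / g + h}.
Proof.
move=> g h; case: (dpi_surj g) (dpi_surj h) => x -> [y ->].
by rewrite -dpiD !rscaleE.
Qed.
HB.instance Definition _ :=
  GRing.Zmodule_isLmodule.Build H W rscaleA rscale1 rscaleDr rscaleDl.

Lemma rep_tgenE i (w : W) : tgen q_neq0 i *: w = rop rho i w.
Proof. exact: (rscaleE (DGen i)). Qed.
Lemma rep_tinvE i (w : W) : tinv q_neq0 i *: w = ropV rho i w.
Proof. exact: (rscaleE (DInv i)). Qed.
Lemma rep_constE a (w : W) : (a *: (1 : H)) *: w = (a *: (w : V) : V).
Proof. by rewrite -dpiC; exact: (rscaleE (DConst a)). Qed.

End RepModule.

(* If every T_i satisfies T_i^2 - c_i T_i + 1 = 0, then T_i is invertible and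
   T_i + T_i^-1 is the scalar c_i. This is how the actions of the t_i on M and
   E, given without those of the t_i^-1, determine modules. *)
Section QuadraticRep.
Variables (F : fieldType) (q : F) (V : lmodType F).
Variables (T : 'I_4 -> V -> V) (c : 'I_4 -> F).
Hypothesis T_linear : forall i, linear (T i).
Hypothesis T_quad : forall i v, T i (T i v) = c i *: T i v - v.
Hypothesis T_prod : forall v, T i0 (T i1 (T i2 (T i3 v))) = q^-1 *: v.

Let TV i v := c i *: v - T i v.

Let TZ i a v : T i (a *: v) = a *: T i v.
Proof.
have T0 : T i 0 = 0.
  apply: (addrI (T i 0)); rewrite addr0.
  by have := T_linear i 1 0 0; rewrite !scale1r addr0.
by have := T_linear i a v 0; rewrite T0 !addr0.
Qed.

Let TB i u v : T i (u - v) = T i u - T i v.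
Proof.
by have := T_linear i (-1) v u; rewrite !scaleN1r [- v + u]addrC => ->; rewrite addrC.
Qed.

Let TV_linear i : linear (TV i).
Proof.
move=> a u v; rewrite /TV T_linear !scalerDr opprD addrACA scalerN.
by congr (_ - _ + _); rewrite !scalerA mulrC.
Qed.

Let TK i : cancel (T i) (TV i).
Proof. by move=> v; rewrite /TV T_quad opprB addrC subrK. Qed.

Let TVK i : cancel (TV i) (T i).
Proof. by move=> v; rewrite /TV TB TZ T_quad opprB addrC subrK. Qed.

Let T_central i j v : T i (T j v) + TV i (T j v) = T j (T i v + TV i v).
Proof. by rewrite /TV ![T i _ + _]addrC !subrK TZ. Qed.

Definition quad_rep : DAHA_rep q V :=
  DAHARep T_linear TV_linear TK TVK T_central T_prod.

End QuadraticRep.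

Section ModuleM.
Variables (F : fieldType) (q k0 k1 k2 k3 : F).

Local Notation m := (fun i : nat => 'X^i : {poly F}).

Definition Mt0 (i : nat) : {poly F} :=
  if i == 0 then k0 *: m 0
  else if odd i then (k0^-1 * q ^- i.+1) *: (m i - m i.+1)
  else (k0^-1 * q ^- i * (1 - q ^+ i) * (1 - k0 ^+ 2 * q ^+ i)) *: m i.-1
       + (k0 + k0^-1 - k0^-1 * q ^- i) *: m i.

Definition Mt1 (i : nat) : {poly F} :=
  if i == 0 then k1 *: m 0 + k1^-1 *: m 1
  else if odd i then k1^-1 *: m i
  else (- k1 * (1 - q ^+ i) * (1 - k0 ^+ 2 * q ^+ i)) *: m i.-1
       + k1 *: m i + k1^-1 *: m i.+1.

Definition Mt2 (i : nat) : {poly F} :=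
  if odd i then
    ((k0 * k1 * k3 * q ^+ i - k2) * (k0 * k1 * k3 * q ^+ i - k2^-1)
      / (k0 * k1 * k3 * q ^+ i)) *: m i.-1
    + (k2 + k2^-1 - k0^-1 * k1^-1 * k3^-1 * q ^- i) *: m i
  else (k0^-1 * k1^-1 * k3^-1 * q ^- i.+1) *: (m i - m i.+1).

Definition Mt3 (i : nat) : {poly F} :=
  if odd i then
    (- k3^-1 * (k0 * k1 * k3 * q ^+ i - k2) * (k0 * k1 * k3 * q ^+ i - k2^-1))
      *: m i.-1
    + k3^-1 *: m i + k3 *: m i.+1
  else k3 *: m i.

Definition Mt (j : 'I_4) : nat -> {poly F} :=
  match val j with 0 => Mt0 | 1 => Mt1 | 2 => Mt2 | _ => Mt3 end.

Definition poly_lin (V : lmodType F) (b : nat -> V) (p : {poly F}) : V :=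
  \sum_(i < size p) p`_i *: b i.

Lemma poly_lin_wide (V : lmodType F) (b : nat -> V) (p : {poly F}) n :
  (size p <= n)%N -> poly_lin b p = \sum_(i < n) p`_i *: b i.
Proof.
move=> le_pn; rewrite /poly_lin (big_ord_widen n (fun i => p`_i *: b i) le_pn).
rewrite big_mkcond; apply: eq_bigr => i _.
by case: ltnP => // h; rewrite nth_default // scale0r.
Qed.

Lemma poly_lin_linear (V : lmodType F) (b : nat -> V) : linear (poly_lin b).
Proof.
move=> a p r; pose n := maxn (size p) (size r).
have hp : (size p <= n)%N by rewrite leq_maxl.
have hr : (size r <= n)%N by rewrite leq_maxr.
have hs : (size (a *: p + r)%R <= n)%N.
  rewrite (leq_trans (size_polyD _ _)) // geq_max hr andbT.
  exact: leq_trans (size_scale_leq _ _) hp.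
rewrite (poly_lin_wide _ hp) (poly_lin_wide _ hr) (poly_lin_wide _ hs).
rewrite scaler_sumr -big_split /=; apply: eq_bigr => i _.
by rewrite coefD coefZ scalerDl scalerA.
Qed.

HB.instance Definition _ (V : lmodType F) (b : nat -> V) :=
  GRing.isLinear.Build F {poly F} V *:%R (poly_lin b) (poly_lin_linear b).

Lemma poly_linXn (V : lmodType F) (b : nat -> V) i : poly_lin b 'X^i = b i.
Proof.
rewrite /poly_lin size_polyXn big_ord_recr /= coefXn eqxx scale1r.
rewrite big1 ?add0r // => j _; rewrite coefXn.
by rewrite (ltn_eqF (ltn_ord j)) scale0r.
Qed.

Lemma poly_lin_ext (V : lmodType F) (f g : {poly F} -> V) :
  linear f -> linear g -> (forall i, f 'X^i = g 'X^i) -> f =1 g.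
Proof.
have linE (h : {poly F} -> V) (p : {poly F}) : linear h ->
    h p = \sum_(i < size p) p`_i *: h 'X^i.
  move=> h_lin; pose hh : {linear {poly F} -> V} :=
    HB.pack h (GRing.isLinear.Build F {poly F} V *:%R h h_lin).
  rewrite -[h]/(hh : _ -> _) -{1}[p]coefK poly_def linear_sum.
  by apply: eq_bigr => i _; rewrite linearZ.
move=> f_lin g_lin fg p; rewrite (linE f) // (linE g) //.
by apply: eq_bigr => i _; rewrite fg.
Qed.

Lemma poly_linD (V : lmodType F) (b : nat -> V) :
  {morph poly_lin b : x y / x + y}.
Proof. exact: linearD. Qed.
Lemma poly_linN (V : lmodType F) (b : nat -> V) :
  {morph poly_lin b : x / - x}.
Proof. exact: linearN. Qed.
Lemma poly_linZ (V : lmodType F) (b : nat -> V) a :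
  {morph poly_lin b : x / a *: x}.
Proof. by move=> x; rewrite linearZ. Qed.
Definition poly_linE := (poly_linD, poly_linN, poly_linZ, poly_linXn).

Definition Mtr (j : 'I_4) : F :=
  match val j with
  | 0 => k0 + k0^-1 | 1 => k1 + k1^-1 | 2 => k2 + k2^-1 | _ => k3 + k3^-1
  end.

Hypothesis q_neq0 : q != 0.
Hypotheses (k0_neq0 : k0 != 0) (k1_neq0 : k1 != 0).
Hypotheses (k2_neq0 : k2 != 0) (k3_neq0 : k3 != 0).

Let nat_case (P : nat -> Prop) :
  P 0 -> (forall j, ~~ odd j -> P j.+1) -> (forall j, ~~ odd j -> P j.+2) ->
  forall i, P i.
Proof.
move=> h0 h1 h2 [//|i]; case oi: (odd i); last by apply: h1; rewrite oi.
by case: i oi => // i /= oi; apply: h2.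
Qed.

Let cE := (coefD, coefN, coefZ, coefXn).

Ltac Mnorm oi :=
  rewrite ?poly_linE ?/Mt0 ?/Mt1 ?/Mt2 ?/Mt3 /= ?oi /=.

Ltac Mfield i :=
  let n := fresh "n" in
  apply/polyP => n; rewrite ?cE ?exprS ?expr0;
  repeat (let x := fresh "x" in
          set x := (((n == _) : bool)%:R : F); clearbody x);
  move: (expf_neq0 i q_neq0); move: (q ^+ i) => Q Q_neq0;
  field; rewrite ?q_neq0 ?k0_neq0 ?k1_neq0 ?k2_neq0 ?k3_neq0 //=;
  do ?[apply/andP; split] => //.

Lemma M_quad_basis j i :
  poly_lin (Mt j) (Mt j i) = Mtr j *: Mt j i - 'X^i.
Proof.
case: j => -[|[|[|[|//]]]] lj; rewrite /Mt /Mtr /=; move: i;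
  apply: nat_case => [|i /negbTE oi|i /negbTE oi].
all: Mnorm oi; Mnorm oi; Mnorm oi.
- Mfield 0%N.
- Mfield i.
- Mfield i.
- Mfield 0%N.
- Mfield i.
- Mfield i.
- Mfield 0%N.
- Mfield i.
- Mfield i.
- Mfield 0%N.
- Mfield i.
- Mfield i.
Qed.

Lemma M_prod_basis i :
  poly_lin (Mt i0) (poly_lin (Mt i1) (poly_lin (Mt i2) (Mt i3 i)))
  = q^-1 *: 'X^i.
Proof.
rewrite /Mt /=; move: i; apply: nat_case => [|i /negbTE oi|i /negbTE oi].
- do 8 Mnorm oi. Mfield 0%N.
- do 8 Mnorm oi. Mfield i.
- do 8 Mnorm oi. Mfield i.
Qed.

Lemma M_quad j (p : {poly F}) :
  poly_lin (Mt j) (poly_lin (Mt j) p) = Mtr j *: poly_lin (Mt j) p - p.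
Proof.
move: p; apply: poly_lin_ext => [a u w|a u w|i].
- by rewrite !linearP.
- by rewrite linearP scalerBr scalerDr opprD addrACA !scalerA mulrC.
- by rewrite poly_linXn M_quad_basis.
Qed.

Lemma M_prod (p : {poly F}) :
  poly_lin (Mt i0) (poly_lin (Mt i1) (poly_lin (Mt i2) (poly_lin (Mt i3) p)))
  = q^-1 *: p.
Proof.
move: p; apply: poly_lin_ext => [a u w|a u w|i].
- by rewrite !linearP.
- by rewrite scalerDr !scalerA mulrC.
- by rewrite poly_linXn M_prod_basis.
Qed.

Definition M_rep : DAHA_rep q {poly F} :=
  quad_rep (fun j => @poly_lin_linear _ (Mt j)) M_quad M_prod.

(* M(k0,k1,k2,k3): the space {poly F}, with 'X^i in the role of m_i *)
Definition moduleM : lmodType (DAHA q_neq0) := rep_module q_neq0 M_rep.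

Definition Mbasis (i : nat) : moduleM := 'X^i : {poly F}.

Lemma tgen_Mbasis j i : tgen q_neq0 j *: Mbasis i = (Mt j i : {poly F}).
Proof. by rewrite [LHS]rep_tgenE /= poly_linXn. Qed.

End ModuleM.

Section AlgebraStructure.
Variables (F : fieldType) (q : F) (q_neq0 : q != 0).
Local Notation H := (DAHA q_neq0).

Lemma DAHA_neq0 : (1 : H) != 0.
Proof.
have n1 := oner_neq0 F; pose M := moduleM q_neq0 n1 n1 n1 n1.
apply/eqP => h; have /eqP := oner_neq0 {poly F}; apply.
by rewrite -[LHS](scale1r (1 : M)) h scale0r.
Qed.

HB.instance Definition _ := GRing.PzSemiRing_isNonZero.Build H DAHA_neq0.
HB.instance Definition _ := GRing.Lmodule_isLalgebra.Build F H (@dscaleAl F q q_neq0).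
HB.instance Definition _ := GRing.Lalgebra_isAlgebra.Build F H (@dscaleAr F q q_neq0).

End AlgebraStructure.

Section ModuleE.
Variables (F : fieldType) (q : F) (d : nat) (k0 k1 k2 k3 : F).

(* the standard basis vector for i <= d, and 0 for i > d *)
Definition rowv (i : nat) : 'rV[F]_d.+1 := \row_(j < d.+1) (j == i :> nat)%:R.

Local Notation v := rowv.

Definition Et0 (i : nat) : 'rV[F]_d.+1 :=
  if i == 0 then k0 *: v 0
  else if i == d then k0 *: v d
  else if odd i then (k0^-1 * q ^- i.+1) *: (v i - v i.+1)
  else (k0^-1 * q ^- i * (1 - q ^+ i) * (1 - k0 ^+ 2 * q ^+ i)) *: v i.-1
       + (k0 + k0^-1 - k0^-1 * q ^- i) *: v i.

Definition Et1 (i : nat) : 'rV[F]_d.+1 :=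
  if i == 0 then k1 *: v 0 + k1^-1 *: v 1
  else if odd i then k1^-1 *: v i
  else (- k1 * (1 - q ^+ i) * (1 - k0 ^+ 2 * q ^+ i)) *: v i.-1
       + k1 *: v i + k1^-1 *: v i.+1.

Definition Et2 (i : nat) : 'rV[F]_d.+1 :=
  if odd i then
    ((k0 * k1 * k3 * q ^+ i - k2) * (k0 * k1 * k3 * q ^+ i - k2^-1)
      / (k0 * k1 * k3 * q ^+ i)) *: v i.-1
    + (k2 + k2^-1 - k0^-1 * k1^-1 * k3^-1 * q ^- i) *: v i
  else (k0^-1 * k1^-1 * k3^-1 * q ^- i.+1) *: (v i - v i.+1).

Definition Et3 (i : nat) : 'rV[F]_d.+1 :=
  if odd i then
    if i == d then
      (- k3^-1 * (k0 * k1 * k3 * q ^+ d - k2)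
        * (k0 * k1 * k3 * q ^+ d - k2^-1)) *: v d.-1
      + k3^-1 *: v d
    else
      (- k3^-1 * (k0 * k1 * k3 * q ^+ i - k2)
        * (k0 * k1 * k3 * q ^+ i - k2^-1)) *: v i.-1
      + k3^-1 *: v i + k3 *: v i.+1
  else k3 *: v i.

Definition Et (j : 'I_4) : nat -> 'rV[F]_d.+1 :=
  match val j with 0 => Et0 | 1 => Et1 | 2 => Et2 | _ => Et3 end.

(* Only the values [b i] with i <= d matter. *)
Definition row_lin (V : lmodType F) (b : nat -> V) (w : 'rV[F]_d.+1) : V :=
  \sum_(i < d.+1) w ord0 i *: b i.

Lemma row_lin_linear (V : lmodType F) (b : nat -> V) : linear (row_lin b).
Proof.
move=> a x y; rewrite /row_lin scaler_sumr -big_split /=.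
by apply: eq_bigr => i _; rewrite !mxE scalerDl scalerA.
Qed.

HB.instance Definition _ (V : lmodType F) (b : nat -> V) :=
  GRing.isLinear.Build F 'rV[F]_d.+1 V *:%R (row_lin b) (row_lin_linear b).

Lemma row_lin_rowv (V : lmodType F) (b : nat -> V) i :
  row_lin b (v i) = if (i <= d)%N then b i else 0.
Proof.
rewrite /row_lin; case: leqP => h.
  rewrite (bigD1 (Ordinal (h : (i < d.+1)%N))) //= mxE eqxx scale1r big1 ?addr0 //.
  by move=> j; rewrite -val_eqE /= mxE => /negbTE ->; rewrite scale0r.
rewrite big1 // => j _; rewrite mxE.
by rewrite (ltn_eqF (leq_trans (ltn_ord j) h)) scale0r.
Qed.

Lemma rowv_out i : (d < i)%N -> v i = 0.
Proof.
move=> h; apply/rowP => j; rewrite !mxE.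
by rewrite (ltn_eqF (leq_trans (ltn_ord j) h)).
Qed.

Lemma rowv_sum (w : 'rV[F]_d.+1) : w = \sum_(i < d.+1) w ord0 i *: v i.
Proof.
apply/rowP => j; rewrite summxE (bigD1 j) //= !mxE eqxx mulr1 big1 ?addr0 //.
by move=> i; rewrite -val_eqE /= !mxE eq_sym => /negbTE ->; rewrite mulr0.
Qed.

Hypotheses (q_neq0 : q != 0) (d_odd : odd d).
Hypotheses (k0_neq0 : k0 != 0) (k1_neq0 : k1 != 0).
Hypotheses (k2_neq0 : k2 != 0) (k3_neq0 : k3 != 0).
Hypothesis k0_sq : k0 ^+ 2 = q ^- d.+1.

Let proj : {poly F} -> 'rV[F]_d.+1 := poly_lin v.

Let d_gt0 : (0 < d)%N. Proof. by case: (d) d_odd. Qed.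

Let projE := (linearD, linearN, linearZ, poly_linXn).

Lemma Et_proj j i :
  proj (Mt q k0 k1 k2 k3 j i) = if (i <= d)%N then Et j i else 0.
Proof.
have vd1 : v d.+1 = 0 by apply: rowv_out.
have hd1 : 1 - k0 ^+ 2 * q ^+ d.+1 = 0 by rewrite k0_sq mulVf ?subrr ?expf_neq0.
have k0d : k0^-1 * q ^- d.+1 = k0 by rewrite -k0_sq expr2 mulKf.
case: leqP => [le_id|].
  case: j => -[|[|[|[|//]]]] lj;
    rewrite /Mt /Et /= /Mt0 /Mt1 /Mt2 /Mt3 /Et0 /Et1 /Et2 /Et3 /proj.
  - case: (eqVneq i 0) => [_|i_neq0]; first by rewrite !poly_linE.
    case: (eqVneq i d) => [->|i_neqd].
      by rewrite d_odd k0d !poly_linE vd1 subr0.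
    by case: ifP => _; rewrite !poly_linE.
  - case: (eqVneq i 0) => [_|i_neq0]; first by rewrite !poly_linE.
    by case: ifP => _; rewrite !poly_linE.
  - by case: ifP => _; rewrite !poly_linE.
  - case: ifP => _; last by rewrite !poly_linE.
    case: (eqVneq i d) => [->|i_neqd]; rewrite !poly_linE //.
    by rewrite vd1 scaler0 addr0.
rewrite leq_eqVlt => /orP[/eqP <-|lt_di].
  have vd2 : v d.+2 = 0 by apply: rowv_out.
  case: j => -[|[|[|[|//]]]] lj;
    rewrite /Mt /= /Mt0 /Mt1 /Mt2 /Mt3 /proj /= ?d_odd /= !poly_linE
      ?vd1 ?vd2 ?hd1 ?(mulr0, scale0r, scaler0, addr0, subr0) //.
case: i lt_di => // i lt_di.
have vi : v i = 0 by apply: rowv_out.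
have vi1 : v i.+1 = 0 by apply: rowv_out; apply: ltnW.
have vi2 : v i.+2 = 0 by apply: rowv_out; apply: ltnW; apply: ltnW.
case: j => -[|[|[|[|//]]]] lj;
  rewrite /Mt /= /Mt0 /Mt1 /Mt2 /Mt3 /proj /=; case: ifP => _;
  by rewrite !poly_linE ?vi ?vi1 ?vi2 ?(subr0, scaler0, addr0).
Qed.

Let Mop j := poly_lin (Mt q k0 k1 k2 k3 j).
Let Eop j := row_lin (Et j).

Lemma Eop_proj j p : Eop j (proj p) = proj (Mop j p).
Proof.
move: p; apply: poly_lin_ext => [a u w|a u w|i].
- by rewrite /Eop /proj !linearP.
- by rewrite /Mop /proj !linearP.
- by rewrite /Eop /Mop /proj !poly_linXn row_lin_rowv -Et_proj.
Qed.

Lemma proj_surj w : exists p, w = proj p.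
Proof.
exists (\sum_(i < d.+1) w ord0 i *: 'X^i); rewrite {1}(rowv_sum w).
rewrite /proj linear_sum /=; apply: eq_bigr => i _.
by rewrite linearZ /= poly_linXn.
Qed.

Lemma E_quad j w :
  Eop j (Eop j w) = Mtr k0 k1 k2 k3 j *: Eop j w - w.
Proof.
case: (proj_surj w) => p ->; rewrite !Eop_proj /Mop M_quad //.
by rewrite /proj linearB linearZ.
Qed.

Lemma E_prod w : Eop i0 (Eop i1 (Eop i2 (Eop i3 w))) = q^-1 *: w.
Proof.
case: (proj_surj w) => p ->; rewrite !Eop_proj /Mop M_prod //.
by rewrite /proj linearZ.
Qed.

Definition E_rep : DAHA_rep q 'rV[F]_d.+1 :=
  quad_rep (fun j => @row_lin_linear _ (Et j)) E_quad E_prod.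

(* E(k0,k1,k2,k3): the space of row vectors, with [rowv i] in the role of v_i *)
Definition moduleE : lmodType (DAHA q_neq0) := rep_module q_neq0 E_rep.

Definition Ebasis (i : nat) : moduleE := rowv i.

Lemma tgen_Ebasis j i : (i <= d)%N ->
  tgen q_neq0 j *: Ebasis i = (Et j i : 'rV[F]_d.+1).
Proof. by move=> le_id; rewrite [LHS]rep_tgenE /= row_lin_rowv le_id. Qed.

End ModuleE.

Section SubmoduleQuotient.
Variables (R : pzRingType) (V : lmodType R) (x : V).

Definition gen_submod : {pred V} :=
  [pred y | `[< forall P : {pred V}, submod_closed P -> x \in P -> y \in P >]].

Lemma gen_submodP y :
  reflect (forall P : {pred V}, submod_closed P -> x \in P -> y \in P)
          (y \in gen_submod).
Proof. exact: asboolP. Qed.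

Lemma mem_gen_submod : x \in gen_submod.
Proof. exact/gen_submodP. Qed.

Lemma gen_submod_closed : submod_closed gen_submod.
Proof.
split=> [|a u v /gen_submodP hu /gen_submodP hv]; apply/gen_submodP => P PC xP.
  by case: PC.
by case: (PC) => _; apply; [apply: hu | apply: hv].
Qed.

HB.instance Definition _ :=
  GRing.isSubmodClosed.Build R V gen_submod gen_submod_closed.

(* the quotient of V by the submodule generated by x *)
Definition gen_quot : Type := Quotient.quot gen_submod.

HB.instance Definition _ := GRing.Zmodule.on gen_quot.
HB.instance Definition _ := EqQuotient.on gen_quot.

Definition quot_pi (y : V) : gen_quot := \pi_gen_quot y.

Lemma quot_piP y z : quot_pi y = quot_pi z <-> y - z \in gen_submod.
Proof.
split=> [/eqP|h]; last apply/eqP; rewrite /quot_pi piE Quotient.equivE //.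
Qed.

Lemma quot_piB y z : quot_pi (y - z) = quot_pi y - quot_pi z.
Proof. by rewrite /quot_pi piE. Qed.

Lemma quot_piD y z : quot_pi (y + z) = quot_pi y + quot_pi z.
Proof. by rewrite /quot_pi piE. Qed.

Definition quot_scale (a : R) (w : gen_quot) : gen_quot :=
  quot_pi (a *: repr w).

Lemma quot_scaleE a y : quot_scale a (quot_pi y) = quot_pi (a *: y).
Proof.
apply/quot_piP; rewrite -scalerBr rpredZ //.
by apply/quot_piP; rewrite /quot_pi reprK.
Qed.

Lemma quot_pi_surj w : exists y, w = quot_pi y.
Proof. by exists (repr w); rewrite /quot_pi reprK. Qed.

Lemma quot_scaleA a b w : quot_scale a (quot_scale b w) = quot_scale (a * b) w.
Proof. by case: (quot_pi_surj w) => y ->; rewrite !quot_scaleE scalerA. Qed.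
Lemma quot_scale1 : left_id 1 quot_scale.
Proof. by move=> w; case: (quot_pi_surj w) => y ->; rewrite quot_scaleE scale1r. Qed.
Lemma quot_scaleDr : right_distributive quot_scale +%R.
Proof.
move=> a w z; case: (quot_pi_surj w) (quot_pi_surj z) => {}w -> [{}z ->].
by rewrite -quot_piD !quot_scaleE scalerDr quot_piD.
Qed.
Lemma quot_scaleDl w : {morph quot_scale^~ w : a b / a + b}.
Proof.
move=> a b; case: (quot_pi_surj w) => {}w ->.
by rewrite !quot_scaleE scalerDl quot_piD.
Qed.
HB.instance Definition _ := GRing.Zmodule_isLmodule.Build R gen_quot
  quot_scaleA quot_scale1 quot_scaleDr quot_scaleDl.

Lemma quot_pi_linear : linear quot_pi.
Proof. by move=> a y z; rewrite quot_piD -quot_scaleE. Qed.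

End SubmoduleQuotient.

(* Main.v *)
Require Import Defs.
From HB Require Import structures.
From mathcomp Require Import all_boot all_order all_algebra.

(** Truncation gives the isomorphism.  Let proj : M -> E ([truncation])
    send m_i to v_i for i <= d and to 0 for i > d.  The hypothesis
    on k0 says that the factor 1 - k0^2 q^(d+1) vanishes: in M neither t_0
    nor t_1 leads from m_(d+1) back to m_d, so the span of the m_i with
    i > d is stable and the action on E is the induced one ([Eop_proj]).  Hence proj is a map of modules
    ([truncation_linear]).  It is onto, and its kernel is that span.

    The span is the submodule N generated by m_(d+1).  It contains N, being a
    kernel containing m_(d+1).  Conversely t_2 m_i (i even) and t_0 m_i (i odd)
    are nonzero multiples of m_i - m_(i+1), so one generator at a time climbs
    from m_(d+1) to every later m_i ([Mbasis_mem_submod]).  The kernel is thus N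
    ([mem_gen_submod_truncation]), and the first isomorphism theorem
    ([gen_quot_iso]) turns proj into an isomorphism M / N -> E.

    For uniqueness, any candidate kills the classes of the m_i with i > d, so
    its values on all the m_i are prescribed, and a module map out of M is
    determined by these values ([moduleM_ext]). *)

Set Implicit Arguments.
Unset Strict Implicit.
Unset Printing Implicit Defensive.

Import GRing.Theory.
Local Open Scope ring_scope.

Lemma gen_quot_iso (R : pzRingType) (V W : lmodType R) (x : V) (g : V -> W) :
    linear g -> (forall y, y \in gen_submod x <-> g y = 0) ->
    (forall w, exists y, g y = w) ->
  exists f : gen_quot x -> W,
    [/\ linear f, bijective f & forall y, f (quot_pi x y) = g y].
Proof.
move=> g_lin g_ker g_surj.
have gB y z : g (y - z) = g y - g z.
  by rewrite addrC -scaleN1r g_lin scaleN1r addrC.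
have fE y : g (repr (quot_pi x y)) = g y.
  apply/eqP; rewrite -subr_eq0 -gB; apply/eqP/g_ker/quot_piP.
  by rewrite /quot_pi reprK.
pose f (w : gen_quot x) : W := g (repr w).
have f_inj : injective f.
  move=> w z; case: (quot_pi_surj w) (quot_pi_surj z) => {}w -> [{}z ->].
  rewrite /f !fE => gwz; apply/quot_piP/g_ker.
  by rewrite gB gwz subrr.
have f_surj w : exists y, f y == w.
  by case: (g_surj w) => y <-; exists (quot_pi x y); rewrite /f fE.
exists f; split=> [a w z| |//].
  case: (quot_pi_surj w) (quot_pi_surj z) => {}w -> [{}z ->].
  by rewrite -quot_pi_linear /f !fE g_lin.
have fK w : f (xchoose (f_surj w)) = w by apply/eqP/(xchooseP (f_surj w)).
by exists (fun w => xchoose (f_surj w)) => // w; apply: f_inj; rewrite fK.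
Qed.

(** Scalars of F act through the subalgebra F 1, so linearity over the
    algebra contains linearity over the base field. *)
Lemma rep_module_linear (F : fieldType) (q : F) (q_neq0 : q != 0)
    (V W : lmodType F) (rho : DAHA_rep q V) (sigma : DAHA_rep q W)
    (g : rep_module q_neq0 rho -> rep_module q_neq0 sigma) :
  linear g -> linear (g : V -> W).
Proof.
move=> g_lin a u v; rewrite -[a *: u](rep_constE (q_neq0 := q_neq0) (rho := rho)).
rewrite -[a *: (g u : W)](rep_constE (q_neq0 := q_neq0) (rho := sigma)).
exact: g_lin.
Qed.

(** The algebra is generated by the letters t_i and t_i^-1, and commuting with
    t_i implies commuting with its inverse. *)
Lemma intertwiner_linear (F : fieldType) (q : F) (q_neq0 : q != 0)
    (V W : lmodType F) (rho : DAHA_rep q V) (sigma : DAHA_rep q W)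
    (g : {linear V -> W}) :
  (forall j v, rop sigma j (g v) = g (rop rho j v)) ->
  linear (g : rep_module q_neq0 rho -> rep_module q_neq0 sigma).
Proof.
move=> gT h u v; case: (dpi_surj h) => x ->.
rewrite [_ *: u](rscaleE (rho := rho)).
rewrite [_ *: (g u : rep_module q_neq0 sigma)](rscaleE (rho := sigma)).
rewrite [LHS](linearD g); congr (_ + _).
elim: x u {v h} => [a|i|i|x IHx y IHy|x IHx|x IHx y IHy] u /=.
- exact: linearZ.
- by rewrite gT.
- by apply: (can_inj (ropK sigma i)); rewrite ropVK gT ropVK.
- by rewrite linearD IHx IHy.
- by rewrite linearN IHx.
- by rewrite IHx IHy.
Qed.

Section Truncation.
Variables (F : fieldType) (q : F) (q_neq0 : q != 0).
Variables (d : nat) (d_odd : odd d) (k0 k1 k2 k3 : F).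
Hypotheses (k0_neq0 : k0 != 0) (k1_neq0 : k1 != 0).
Hypotheses (k2_neq0 : k2 != 0) (k3_neq0 : k3 != 0).
Hypothesis k0_sq : k0 ^+ 2 = q ^- d.+1.

Local Notation M := (moduleM q_neq0 k0_neq0 k1_neq0 k2_neq0 k3_neq0).
Local Notation m := (Mbasis q_neq0 k0_neq0 k1_neq0 k2_neq0 k3_neq0).
Local Notation E :=
  (moduleE q_neq0 d_odd k0_neq0 k1_neq0 k2_neq0 k3_neq0 k0_sq).
Local Notation N := (gen_submod (m d.+1)).

Definition truncation : M -> E := poly_lin (rowv F d).

Lemma truncation_linear : linear truncation.
Proof.
apply: (intertwiner_linear (g := poly_lin (rowv F d))) => j p.
exact: Eop_proj.
Qed.

Lemma poly_lin_rowv_coef (p : {poly F}) (j : 'I_d.+1) :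
  poly_lin (rowv F d) p ord0 j = p`_j.
Proof.
rewrite (poly_lin_wide _ (leq_maxl (size p) d.+1)) summxE.
rewrite (bigD1 (widen_ord (leq_maxr _ _) j)) //= !mxE eqxx mulr1 big1 ?addr0 //.
by move=> i; rewrite -val_eqE /= !mxE eq_sym => /negbTE ->; rewrite mulr0.
Qed.

Lemma truncation_surj (w : E) : exists p, truncation p = w.
Proof. by case: (proj_surj w) => p ->; exists p. Qed.

Lemma truncation_Mbasis i : truncation (m i) = rowv F d i.
Proof. exact: poly_linXn. Qed.

(** Use t_2 for even i and t_0 for odd i: they reach m_(i+1) without an
    m_(i-1) term, so m_i alone generates m_(i+1). *)
Lemma Mbasis_succ i : exists h : DAHA q_neq0, m i.+1 = h *: m i.
Proof.
suff [j [c c_neq0 tE]] : exists j, exists2 c : F, c != 0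
    & Mt q k0 k1 k2 k3 j i = c *: ('X^i - 'X^(i.+1)).
  exists (1 - (c^-1 *: 1) * tgen q_neq0 j).
  rewrite scalerBl scale1r -scalerA tgen_Mbasis tE.
  rewrite [(_ *: 1) *: _]rep_constE scalerA mulVf // scale1r.
  by rewrite [RHS]subKr.
case oi: (odd i).
- exists i0, (k0^-1 * q ^- i.+1).
    by rewrite mulf_neq0 ?invr_eq0 ?expf_neq0.
  by case: i oi => // i oi; rewrite /Mt /= /Mt0 oi.
- exists i2, (k0^-1 * k1^-1 * k3^-1 * q ^- i.+1).
    by rewrite !mulf_neq0 ?invr_eq0 ?expf_neq0.
  by rewrite /Mt /= /Mt2 oi.
Qed.

Lemma Mbasis_mem_submod i : (d < i)%N -> m i \in N.
Proof.
elim: i => // i IHi; rewrite ltnS leq_eqVlt => /orP[/eqP <-|/IHi mi].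
  exact: mem_gen_submod.
by case: (Mbasis_succ i) => h ->; apply: rpredZ.
Qed.

Lemma mem_gen_submod_truncation (p : M) : p \in N <-> truncation p = 0.
Proof.
split=> [/gen_submodP pN|p0].
  apply/eqP; apply: (pN [pred p | truncation p == 0]).
  - have t0 : truncation 0 = 0 by apply: linear0.
    split=> [|h u v]; rewrite !inE ?t0 // => /eqP u0 /eqP v0.
    by rewrite truncation_linear u0 v0 scaler0 addr0.
  - by rewrite inE truncation_Mbasis rowv_out.
rewrite -[p](coefK (p : {poly F})) poly_def.
apply: (rpred_sum (V := M)) => i _.
have [le_id|lt_di] := leqP i d.
  rewrite -(poly_lin_rowv_coef _ (Ordinal (le_id : (i < d.+1)%N))).
  rewrite [poly_lin _ _]p0 mxE scale0r; exact: (rpred0 (V := M)).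
(* N is closed under the algebra, so p`_i has to act as the element p`_i 1. *)
rewrite -[_ *: _](rep_constE (q_neq0 := q_neq0) (rho := M_rep _ _ _ _ _)).
by apply: rpredZ; apply: Mbasis_mem_submod.
Qed.

Lemma moduleM_ext (f g : M -> E) :
  linear f -> linear g -> (forall i, f (m i) = g (m i)) -> f =1 g.
Proof.
move=> f_lin g_lin fg.
by apply: (@poly_lin_ext F 'rV[F]_d.+1) => //; apply: rep_module_linear.
Qed.

End Truncation.

Theorem lemma5p3 (F : fieldType) (q : F) (q_neq0 : q != 0)
    (d : nat) (d_odd : odd d) (k0 k1 k2 k3 : F)
    (k0_neq0 : k0 != 0) (k1_neq0 : k1 != 0)
    (k2_neq0 : k2 != 0) (k3_neq0 : k3 != 0)
    (k0_sq : k0 ^+ 2 = q ^- d.+1) :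
  let m := Mbasis q_neq0 k0_neq0 k1_neq0 k2_neq0 k3_neq0 in
  let E := moduleE q_neq0 d_odd k0_neq0 k1_neq0 k2_neq0 k3_neq0 k0_sq in
  let v := Ebasis q_neq0 d_odd k0_neq0 k1_neq0 k2_neq0 k3_neq0 k0_sq in
  exists! f : gen_quot (m d.+1) -> E,
    [/\ linear f, bijective f
      & forall i : nat, (i <= d)%N -> f (quot_pi (m d.+1) (m i)) = v i].
Proof.
move=> m E v.
have [f [f_lin f_bij fE]] := gen_quot_iso
  (truncation_linear d_odd k0_sq) (mem_gen_submod_truncation d_odd k0_sq)
  (@truncation_surj _ _ q_neq0 _ d_odd _ _ _ _
     k0_neq0 k1_neq0 k2_neq0 k3_neq0 k0_sq).
exists f; split=> [|g [g_lin _ gE]].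
  by split=> // i _; rewrite fE truncation_Mbasis.
suff fg : f \o quot_pi (m d.+1) =1 g \o quot_pi (m d.+1).
  by apply: boolp.funext => w; case: (quot_pi_surj w) => p ->; apply: fg.
have pi_lin := @quot_pi_linear _ _ (m d.+1).
apply: moduleM_ext => [a y z|a y z|i] /=.
- by rewrite pi_lin f_lin.
- by rewrite pi_lin g_lin.
- rewrite fE truncation_Mbasis; case: (leqP i d) => [/gE -> //|lt_di].
  have -> : quot_pi (m d.+1) (m i) = 0.
    rewrite -(subrr (quot_pi _ 0)) -quot_piB subrr; apply/quot_piP.
    by rewrite subr0 Mbasis_mem_submod.
  have g0 : g 0 = 0.
    by have := g_lin (-1) 0 0; rewrite scaler0 addr0 scaleN1r addNr.
  by rewrite g0 rowv_out.
Qed.
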